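(* Let $ABC$ be a nondegenerate triangle. For every admissible pair of cevians $BB_A, CC_A$ with Miquel–Steiner point $M_A$, one has $B_AC_A\parallel BC$ if and only if $M_A$ belongs to the symmedian line of triangle $ABC$ from $A$ (excluding the point $A$).
   Context: Work in the Euclidean plane with a nondegenerate triangle $ABC$. An admissible pair of cevians consists of lines $BB_A$ and $CC_A$, where $B_A$ is a point of line $AC$ with $B_A\neq A, C$, and $C_A$ is a point of line $AB$ with $C_A\neq A, B$ (the points may lie outside the sides), such that $BB_A$ and $CC_A$ are not parallel. Let $N_A$ be the intersection point of $BB_A$ and $CC_A$. The circumcircles of the four triangles $ABB_A$, $ACC_A$, $CB_AN_A$, $BC_AN_A$ have a unique common point $M_A$, called the Miquel–Steiner point of triangle $ABC$ with cevians $BB_A, CC_A$ (equivalently, $M_A$ is the common point other than $A$ of the circumcircles of $ABB_A$ and $ACC_A$). The symmedian from $A$ is the (full) line through $A$ obtained by reflecting the median line from $A$ in the internal bisector of angle $A$. *)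

(* Defs.v *)
From mathcomp Require Import all_boot all_order all_algebra.
From mathcomp Require Import boolp classical_sets reals.

Set Implicit Arguments.
Unset Strict Implicit.
Unset Printing Implicit Defensive.

Import Order.TTheory GRing.Theory Num.Theory.

Local Open Scope classical_set_scope.
Local Open Scope ring_scope.

(* The library norm on row vectors is the sup norm, so the Euclidean structure
   is built here from the standard inner product. *)
Definition dot (R : realType) (u v : 'rV[R]_2) : R := \sum_i u 0 i * v 0 i.

Definition enorm (R : realType) (u : 'rV[R]_2) : R := Num.sqrt (dot u u).

Definition dist (R : realType) (P Q : 'rV[R]_2) : R := enorm (Q - P).

(* A genuine line only when P != Q; [line P P] is the singleton of P. *)
Definition line (R : realType) (P Q : 'rV[R]_2) : set 'rV[R]_2 :=
  [set P + t *: (Q - P) | t in [set: R]].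

Definition nondegenerate_triangle (R : realType) (A B C : 'rV[R]_2) : Prop :=
  ~ exists P Q : 'rV[R]_2, [/\ line P Q A, line P Q B & line P Q C].

(* Parallelism of distinct lines of the plane. *)
Definition parallel (R : realType) (l m : set 'rV[R]_2) : Prop :=
  l `&` m = set0.

Definition circle (R : realType) (O : 'rV[R]_2) (r : R) : set 'rV[R]_2 :=
  [set X | dist O X = r].

(* The point equidistant from P, Q, S; it exists and is unique when P, Q, S
   are not collinear, and is only used in that case. *)
Definition circumcenter (R : realType) (P Q S : 'rV[R]_2) : 'rV[R]_2 :=
  xget 0 [set O | dist O P = dist O Q /\ dist O P = dist O S].

Definition circumcircle (R : realType) (P Q S : 'rV[R]_2) : set 'rV[R]_2 :=
  circle (circumcenter P Q S) (dist (circumcenter P Q S) P).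

Definition midpoint (R : realType) (P Q : 'rV[R]_2) : 'rV[R]_2 :=
  2^-1 *: (P + Q).

Definition median (R : realType) (A B C : 'rV[R]_2) : set 'rV[R]_2 :=
  line A (midpoint B C).

Definition unit_vector (R : realType) (P Q : 'rV[R]_2) : 'rV[R]_2 :=
  (dist P Q)^-1 *: (Q - P).

(* Second point, besides A, of the internal bisector of the angle BAC: the
   vertex opposite to A of the rhombus spanned by the unit vectors along the
   rays AB and AC. *)
Definition bisector_point (R : realType) (A B C : 'rV[R]_2) : 'rV[R]_2 :=
  A + (unit_vector A B + unit_vector A C).

(* Foot of the perpendicular from X to the line PQ, for P != Q. *)
Definition proj_line (R : realType) (P Q X : 'rV[R]_2) : 'rV[R]_2 :=
  P + (dot (X - P) (Q - P) / dot (Q - P) (Q - P)) *: (Q - P).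

(* Orthogonal reflection in the line PQ: the foot is the midpoint of X and its
   image. *)
Definition reflection (R : realType) (P Q X : 'rV[R]_2) : 'rV[R]_2 :=
  2 *: proj_line P Q X - X.

Definition symmedian (R : realType) (A B C : 'rV[R]_2) : set 'rV[R]_2 :=
  reflection A (bisector_point A B C) @` median A B C.

Definition admissible (R : realType) (A B C B_A C_A : 'rV[R]_2) : Prop :=
  [/\ line A C B_A /\ (B_A <> A /\ B_A <> C),
      line A B C_A /\ (C_A <> A /\ C_A <> B)
    & ~ parallel (line B B_A) (line C C_A)].

Definition cevian_intersection (R : realType) (B C B_A C_A N_A : 'rV[R]_2) :
    Prop :=
  line B B_A `&` line C C_A = [set N_A].

Definition miquel_steiner (R : realType) (A B C B_A C_A N_A M_A : 'rV[R]_2) :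
    Prop :=
  circumcircle A B B_A `&` circumcircle A C C_A
    `&` circumcircle C B_A N_A `&` circumcircle B C_A N_A = [set M_A].

(* Main.v *)
(** Put [b = B - A], [c = C - A], [B_A = A + s c], [C_A = A + t b] and
    [m = M_A - A].  If [A + o1] and [A + o2] are the centres of the circles
    [A B B_A] and [A C C_A], then [m] is orthogonal to [w = 2 (o1 - o2)], where
    [w . b = (1 - t) |b|^2] and [w . c = (s - 1) |c|^2].  The symmedian has
    direction [|b|^2 c + |c|^2 b], whose inner product with [w] is
    [(s - t) |b|^2 |c|^2].  Hence, as soon as [m] is nonzero, [M_A] lies on the
    symmedian iff [s = t], which is the parallelism of [B_A C_A] and [B C].
    Finally [M_A] is not [A], since the circle [C B_A N_A] already meets the
    line [A C] in the two points [C] and [B_A]. *)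
Require Import Defs.
From mathcomp Require Import all_boot all_order all_algebra.
From mathcomp Require Import boolp classical_sets reals.
From mathcomp Require Import ring lra.

Import Order.TTheory GRing.Theory Num.Theory.

Local Open Scope classical_set_scope.
Local Open Scope ring_scope.

Section Plane.
Set Implicit Arguments.
Unset Strict Implicit.

Variable R : realType.
Implicit Types (u v w A B C P Q S T X : 'rV[R]_2) (k s t : R).

Lemma rV2P u v : u = v <-> u 0 0 = v 0 0 /\ u 0 1 = v 0 1.
Proof.
split=> [-> // | [e0 e1]]; apply/rowP => i.
case: (unliftP 0 i) => [j ->|->] //; rewrite ord1.
by have -> : lift 0 0 = 1 :> 'I_2 by exact: val_inj.
Qed.

Lemma dotE u v : dot u v = u 0 0 * v 0 0 + u 0 1 * v 0 1.
Proof.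
rewrite /dot big_ord_recl big_ord1.
by have -> : lift ord0 ord0 = 1 :> 'I_2 by exact: val_inj.
Qed.

Lemma dotC u v : dot u v = dot v u.
Proof. by rewrite !dotE; ring. Qed.

Lemma dotDl u v w : dot (u + v) w = dot u w + dot v w.
Proof. by rewrite !dotE !mxE; ring. Qed.

Lemma dotZl k u v : dot (k *: u) v = k * dot u v.
Proof. by rewrite !dotE !mxE; ring. Qed.

Lemma dotDr u v w : dot u (v + w) = dot u v + dot u w.
Proof. by rewrite dotC dotDl !(dotC u). Qed.

Lemma dotZr k u v : dot u (k *: v) = k * dot u v.
Proof. by rewrite dotC dotZl (dotC u). Qed.

Lemma dot_ge0 u : 0 <= dot u u.
Proof. by rewrite dotE addr_ge0 // -expr2 sqr_ge0. Qed.

Lemma dot_eq0 u : (dot u u == 0) = (u == 0).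
Proof.
apply/eqP/eqP => [|->]; last by rewrite dotE !mxE; ring.
rewrite dotE => /eqP; rewrite paddr_eq0 -?expr2 ?sqr_ge0 // !sqrf_eq0.
by case/andP=> /eqP e0 /eqP e1; apply/rV2P; rewrite e0 e1 !mxE.
Qed.

Definition cross u v : R := u 0 0 * v 0 1 - u 0 1 * v 0 0.

Lemma cross_neq0l u v : cross u v != 0 -> u != 0.
Proof. by apply: contra_neq => ->; rewrite /cross !mxE; ring. Qed.

Lemma cross_neq0r u v : cross u v != 0 -> v != 0.
Proof. by apply: contra_neq => ->; rewrite /cross !mxE; ring. Qed.

Lemma cross_eq0_collinear u v :
  u != 0 -> cross u v = 0 -> v = (dot u v / dot u u) *: u.
Proof.
rewrite -dot_eq0 => u0 uv0; apply/rV2P; rewrite !mxE.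
split; apply: (mulIf u0); rewrite mulrAC divfK // !dotE; apply/eqP;
  rewrite -subr_eq0; apply/eqP.
  rewrite (_ : _ - _ = - u 0 1 * cross u v); first by rewrite uv0 mulr0.
  by rewrite /cross; ring.
rewrite (_ : _ - _ = u 0 0 * cross u v); first by rewrite uv0 mulr0.
by rewrite /cross; ring.
Qed.

Lemma eq_basis u v k k' l l' : cross u v != 0 ->
  k *: u + l *: v = k' *: u + l' *: v -> k = k' /\ l = l'.
Proof.
move=> uv0 /rV2P; rewrite !mxE => -[e0 e1].
split; apply: (mulfI uv0); rewrite /cross.
  have := congr1 ( *%R^~ (v 0 1)) e0; have := congr1 ( *%R^~ (v 0 0)) e1.
  by move=> /=; lra.
have := congr1 ( *%R^~ (u 0 1)) e0; have := congr1 ( *%R^~ (u 0 0)) e1.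
by move=> /=; lra.
Qed.

(** In the plane, the vectors orthogonal to a nonzero [w] form a single line. *)
Lemma orthogonal_collinear w u v :
  w != 0 -> dot w u = 0 -> dot w v = 0 -> cross u v = 0.
Proof.
rewrite -dot_eq0 => w0 wu wv; apply: (mulfI w0); rewrite mulr0.
have -> : dot w w * cross u v =
    dot w u * (w 0 0 * v 0 1 - w 0 1 * v 0 0)
    - dot w v * (w 0 0 * u 0 1 - w 0 1 * u 0 0).
  by rewrite !dotE /cross; ring.
by rewrite wu wv !mul0r subrr.
Qed.

Lemma nondegenerate_cross A B C :
  nondegenerate_triangle A B C -> cross (B - A) (C - A) != 0.
Proof.
move=> nd; apply/eqP => BC0; apply: nd.
have lineP P Q : line P Q P by exists 0 => //; rewrite scale0r addr0.
have lineQ P Q : line P Q Q by exists 1 => //; rewrite scale1r addrC subrK.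
(* When [A = B], [line A B] is a single point, so [line A C] is used instead. *)
have [AB|AB] := eqVneq (B - A) 0.
  by exists A, C; split=> //; rewrite (subr0_eq AB).
exists A, B; split=> //; exists (dot (B - A) (C - A) / dot (B - A) (B - A)) => //.
by rewrite -(cross_eq0_collinear AB BC0) addrC subrK.
Qed.

Lemma eq_dist P Q S T :
  dist P Q = dist S T <-> dot (Q - P) (Q - P) = dot (T - S) (T - S).
Proof.
split; last by rewrite /dist /enorm => ->.
by move/(congr1 (fun x => x ^+ 2)); rewrite !sqr_sqrtr ?dot_ge0.
Qed.

Lemma dist_sqr P Q : dist P Q ^+ 2 = dot (Q - P) (Q - P).
Proof. by rewrite sqr_sqrtr ?dot_ge0. Qed.

Lemma dist_gt0 P Q : Q - P != 0 -> 0 < dist P Q.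
Proof. by rewrite -dot_eq0 sqrtr_gt0 lt0r dot_ge0 andbT. Qed.

(** Taking [P] as origin cancels the square of the centre, so that a circle through [P] becomes an
    equation linear in its centre. *)
Lemma equidistant O P X :
  dist O X = dist O P <-> 2 * dot (O - P) (X - P) = dot (X - P) (X - P).
Proof.
by rewrite eq_dist !dotE !mxE; split => ?; lra.
Qed.

Lemma cramer u v k l : cross u v != 0 ->
  exists w, dot w u = k /\ dot w v = l.
Proof.
move=> uv0; exists (\row_i (if i == 0 then (k * v 0 1 - l * u 0 1) / cross u v
  else (l * u 0 0 - k * v 0 0) / cross u v)).
by rewrite !dotE !mxE /= /cross; split; field; exact: uv0.
Qed.

Lemma circumcircleP P Q S : cross (Q - P) (S - P) != 0 ->
  exists o, [/\ 2 * dot o (Q - P) = dot (Q - P) (Q - P),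
    2 * dot o (S - P) = dot (S - P) (S - P)
    & forall X, circumcircle P Q S X <->
        2 * dot o (X - P) = dot (X - P) (X - P)].
Proof.
move=> PQS; exists (circumcenter P Q S - P).
have [] : dist (circumcenter P Q S) P = dist (circumcenter P Q S) Q /\
          dist (circumcenter P Q S) P = dist (circumcenter P Q S) S.
  (* The default value of [xget] is ruled out by exhibiting a centre: Cramer's rule solves the two
     perpendicular bisector equations. *)
  rewrite /circumcenter; case: xgetP => [O -> //|].
  have [w [wQ wS]] := cramer (dot (Q - P) (Q - P) / 2) (dot (S - P) (S - P) / 2) PQS.
  move/(_ (P + w)); case; split; apply/esym/equidistant;
    by rewrite addrAC subrr add0r ?wQ ?wS; field.
by move=> /esym/equidistant eQ /esym/equidistant eS; split=> // X; exact: equidistant.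
Qed.

(** On the secant [P Q] the circle equation reduces to [k (1 - k) |Q - P|^2 = 0]. *)
Lemma circumcircle_collinear P Q S k : cross (Q - P) (S - P) != 0 ->
  circumcircle P Q S (P + k *: (Q - P)) -> k = 0 \/ k = 1.
Proof.
move=> PQS; have [o [oQ _ ->]] := circumcircleP PQS.
rewrite addrAC subrr add0r !dotZr !dotZl mulrCA oQ => /eqP.
have := cross_neq0l PQS; rewrite -dot_eq0 => Q0.
rewrite -subr_eq0 (_ : _ - _ = k * (1 - k) * dot (Q - P) (Q - P)); last by ring.
by rewrite !mulf_eq0 (negPf Q0) orbF subr_eq0 => /orP[]/eqP; [left|right].
Qed.

(** Let [b], [c] be the sides from [A], of lengths [p], [q], and [d = b/p + c/q]. Twice the
    projection of [(b + c)/2] on [d] is [(p + q)/2 d], and subtracting [(b + c)/2] leaves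
    [(q^2 b + p^2 c)/(2pq)]. *)
Lemma reflection_median A B C t : cross (B - A) (C - A) != 0 ->
  reflection A (bisector_point A B C) (A + t *: (midpoint B C - A)) =
  A + (t / (2 * dist A B * dist A C)) *:
    (dot (B - A) (B - A) *: (C - A) + dot (C - A) (C - A) *: (B - A)).
Proof.
move=> ABC; have p0 := lt0r_neq0 (dist_gt0 (cross_neq0l ABC)).
have q0 := lt0r_neq0 (dist_gt0 (cross_neq0r ABC)).
have mid : midpoint B C - A = 2^-1 *: ((B - A) + (C - A)).
  by apply/rV2P; rewrite !mxE; split; field.
rewrite /reflection /proj_line /bisector_point /unit_vector mid.
rewrite ![A + _ - A]addrAC subrr !add0r -!dist_sqr.
have := dist_sqr A B; have := dist_sqr A C; move: ABC p0 q0.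
move: (B - A) (C - A) (dist A B) (dist A C) => b c p q bc0 p0 q0 eq ep.
set d := _ *: b + _.
have d0 : dot d d != 0.
  rewrite dot_eq0 (@cross_neq0l _ c) //.
  rewrite (_ : cross d c = p^-1 * cross b c) ?mulf_neq0 ?invr_eq0 //.
  by rewrite /cross !mxE; ring.
(* If [a] is the angle at [A], then [(b + c) . d = (p + q)(1 + cos a)] and
   [d . d = 2 (1 + cos a)]. *)
have -> : dot (t *: (2^-1 *: (b + c))) d / dot d d = t * (p + q) / 4.
  apply: (mulIf d0); rewrite divfK // /d.
  rewrite !(dotDl, dotDr, dotZl, dotZr) -ep -eq (dotC c b); field.
  by rewrite p0 q0.
by rewrite /d; apply/rV2P; rewrite !mxE; split; field; rewrite p0 q0.
Qed.

Lemma symmedianP A B C X : cross (B - A) (C - A) != 0 ->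
  symmedian A B C X <-> exists k,
    X = A + k *:
      (dot (B - A) (B - A) *: (C - A) + dot (C - A) (C - A) *: (B - A)).
Proof.
move=> ABC; split.
  by case=> _ [t _ <-] <-; rewrite reflection_median //; eexists.
(* This [t] undoes the scale factor of [reflection_median]. *)
case=> k ->; set t := k * (2 * dist A B * dist A C).
exists (A + t *: (midpoint B C - A)); first by exists t.
rewrite reflection_median // mulfK // !mulf_neq0 ?pnatr_eq0 //.
  exact: lt0r_neq0 (dist_gt0 (cross_neq0l ABC)).
exact: lt0r_neq0 (dist_gt0 (cross_neq0r ABC)).
Qed.

(** As [parallel] means disjoint, [s != 1] serves to exclude that the two lines coincide when
    [s = t]. *)
Lemma parallel_section A B C s t : cross (B - A) (C - A) != 0 -> s != 1 ->
  parallel (line (A + s *: (C - A)) (A + t *: (B - A))) (line B C) <-> s = t.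
Proof.
move=> ABC s1; split=> [par|<-].
  apply/eqP/negPn/negP => st; have ts0 : t - s != 0 by rewrite subr_eq0 eq_sym.
  (* A point of [B C] has coordinates of sum 1 in the basis [B - A], [C - A]; [x] solves
     [x t + (1 - x) s = 1]. *)
  pose x := (1 - s) / (t - s).
  suff : set0 (A + s *: (C - A) + x *: (A + t *: (B - A) - (A + s *: (C - A)))) by [].
  rewrite -par; split; first by exists x.
  exists (1 - x * t) => //; rewrite /x.
  by apply/rV2P; rewrite !mxE; split; field.
apply/seteqP; split=> // X [[x _ <-] [y _ e]].
have [e1 e2] : 1 - y = x * s /\ y = s - x * s.
  apply: (eq_basis ABC); move/rV2P: e; rewrite !mxE => -[e0 e1].
  by apply/rV2P; rewrite !mxE; split; lra.
by move/eqP: s1; apply; lra.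
Qed.

End Plane.

Theorem mainTheorem3 (R : realType) (A B C : 'rV[R]_2)
    (B_A C_A N_A M_A : 'rV[R]_2) :
  nondegenerate_triangle A B C ->
  admissible A B C B_A C_A ->
  cevian_intersection B C B_A C_A N_A ->
  miquel_steiner A B C B_A C_A N_A M_A ->
  parallel (line B_A C_A) (line B C) <-> (symmedian A B C `\ A) M_A.
Proof.
move=> /nondegenerate_cross ABC [].
move=> [[s _ <-{B_A}] [sA sC]] [[t _ <-{C_A}] [tA tB]] _.
have s0 : s != 0 by apply/eqP => s0; apply: sA; rewrite s0 scale0r addr0.
have s1 : s != 1 by apply/eqP => s1; apply: sC; rewrite s1 scale1r addrC subrK.
have t0 : t != 0 by apply/eqP => t0; apply: tA; rewrite t0 scale0r addr0.
have t1 : t != 1 by apply/eqP => t1; apply: tB; rewrite t1 scale1r addrC subrK.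
move=> {sA sC tA tB} /seteqP[_ /(_ N_A erefl) [[x _ eNB] [y _ eNC]]].
move=> /seteqP[_ /(_ M_A erefl) [[[M1 M2] M3] _]].
have MA : M_A <> A.
  (* If [y = 0], then [N_A = C] lies on the line [B B_A], which forces [B_A = C]. Excluding this
     makes the triangle [C B_A N_A] nondegenerate. *)
  have y0 : y != 0.
    apply: contra_neq s1 => y0; rewrite y0 scale0r addr0 in eNC.
    have [] : 1 - x = 0 /\ x * s = 1.
      apply: (eq_basis ABC); move/rV2P: eNB; rewrite -eNC !mxE => -[e0 e1].
      by apply/rV2P; rewrite !mxE; split; lra.
    by move=> /eqP; rewrite subr_eq0 => /eqP <-; rewrite mul1r.
  have CBN : cross (A + s *: (C - A) - C) (N_A - C) != 0.
    rewrite -eNC (_ : cross _ _ = (1 - s) * y * t * cross (B - A) (C - A)).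
      by rewrite !mulf_neq0 // subr_eq0 eq_sym.
    by rewrite /cross !mxE; ring.
  have s1' : 1 - s != 0 by rewrite subr_eq0 eq_sym.
  (* Since [B_A - C = (1 - s)(A - C)], the parameter of [A] on the secant [C B_A] is [1/(1 - s)],
     which is neither 0 nor, as [s != 0], 1. *)
  have eA : A = C + (1 - s)^-1 *: (A + s *: (C - A) - C).
    by apply/rV2P; rewrite !mxE; split; field.
  move=> MA; move: M3; rewrite MA {3}eA => /(circumcircle_collinear CBN) [].
    by apply/eqP; rewrite invr_eq0.
  by move/eqP; rewrite invr_eq1 eq_sym -subr_eq0 opprB addrC subrK; apply/negP.
rewrite parallel_section //.
have c1 : cross (B - A) (A + s *: (C - A) - A) != 0.
  rewrite (_ : cross _ _ = s * cross (B - A) (C - A)) ?mulf_neq0 //.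
  by rewrite /cross !mxE; ring.
have c2 : cross (C - A) (A + t *: (B - A) - A) != 0.
  rewrite (_ : cross _ _ = - t * cross (B - A) (C - A)) ?mulf_neq0 ?oppr_eq0 //.
  by rewrite /cross !mxE; ring.
have [o1 [o1B o1C /(_ M_A)[/(_ M1) o1M _]]] := circumcircleP c1.
have [o2 [o2C o2B /(_ M_A)[/(_ M2) o2M _]]] := circumcircleP c2.
have addKA u : A + u - A = u by rewrite addrAC subrr add0r.
rewrite addKA !dotZr dotZl in o1C; rewrite addKA !dotZr dotZl in o2B.
have bb0 := cross_neq0l ABC; have cc0 := cross_neq0r ABC.
rewrite -!dot_eq0 in bb0 cc0.
have m0 : M_A - A != 0 by rewrite subr_eq0; apply/eqP.
pose w := o1 - o2.
have dotw u : dot w u = dot o1 u - dot o2 u by rewrite !dotE !mxE; ring.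
have wm : dot w (M_A - A) = 0 by rewrite dotw; lra.
have wb : dot w (B - A) = (1 - t) / 2 * dot (B - A) (B - A).
  have : 2 * dot o2 (B - A) = t * dot (B - A) (B - A) by apply: (mulfI t0); lra.
  by rewrite dotw; lra.
have wc : dot w (C - A) = (s - 1) / 2 * dot (C - A) (C - A).
  have : 2 * dot o1 (C - A) = s * dot (C - A) (C - A) by apply: (mulfI s0); lra.
  by rewrite dotw; lra.
(* The two centres are distinct: equal ones would give [w . b = 0], hence [t = 1]. *)
have w0 : w != 0.
  apply: contra_neq t1 => w0; move: wb.
  rewrite w0 (_ : dot 0 _ = 0); last by rewrite dotE !mxE; ring.
  move/esym/eqP; rewrite !mulf_eq0 (negPf bb0) invr_eq0 pnatr_eq0 !orbF.
  by rewrite subr_eq0 => /eqP.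
split=> [st|[/(symmedianP _ ABC) [k eM] _]].
  split=> //; apply/(symmedianP _ ABC).
  set v := dot _ _ *: _ + _.
  have v0 : v != 0.
    apply: (@cross_neq0r _ (B - A)).
    rewrite (_ : cross _ _ = dot (B - A) (B - A) * cross (B - A) (C - A)).
      by rewrite mulf_neq0.
    by rewrite /v /cross !mxE; ring.
  (* Both [v] and [M_A - A] are now orthogonal to [w], hence collinear. *)
  have wv : dot w v = 0 by rewrite /v (dotDr w) !dotZr wb wc st; field.
  exists (dot v (M_A - A) / dot v v).
  rewrite -cross_eq0_collinear // ?(orthogonal_collinear w0) //.
  by rewrite addrC subrK.
have k0 : k != 0 by apply: contra_neq m0 => k0; rewrite eM k0 scale0r addr0 subrr.
(* Orthogonality now reads [k (s - t)/2 |b|^2 |c|^2 = 0], where only [s - t] can vanish. *)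
move: wm; rewrite eM addKA dotZr (dotDr w) !dotZr wb wc.
move: bb0 cc0; move: (dot _ _) (dot _ _) => p q p0 q0 e.
apply/eqP; rewrite -subr_eq0; apply/eqP/(mulfI k0)/(mulfI p0)/(mulfI q0); lra.
Qed.
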